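(* Let $n\ge1$ and let $\lambda\vdash n$ be a partition with exactly $t$ distinct part sizes. For $1\le i\le t$ let $\sigma_i$ be the degree of the left vertex $i$ in $B(\lambda)$, and for $1\le j\le t+1$ let $\tau_j$ be the degree of the right vertex $j$ in $B(\lambda)$. Then $$\omega_{\mathrm{loc}}(\lambda)=1+\max\Bigl\{\max_{1\le i\le t}\sigma_i,\ \max_{1\le j\le t+1}\tau_j\Bigr\},$$ and therefore $$\dim_{\mathrm{loc}}(\lambda)=\max\Bigl\{\max_{1\le i\le t}\sigma_i,\ \max_{1\le j\le t+1}\tau_j\Bigr\}.$$
   Context: A partition $\lambda\vdash n$ is written in block form $\lambda=(s_1^{m_1},\dots,s_t^{m_t})$, where $s_1>\dots>s_t>0$ are its distinct part sizes and $m_i\ge1$ is the multiplicity of $s_i$; put $s_{t+1}:=0$. Corners. The Ferrers diagram of $\lambda$ has exactly $t$ removable corners $c_1,\dots,c_t$, where $c_i$ is the last cell of the last row of length $s_i$, and exactly $t+1$ addable corners $a_1,\dots,a_{t+1}$, where for $1\le j\le t$ the corner $a_j$ is the position just after the end of the first row of length $s_j$ (adding it increases one part of size $s_j$ to $s_j+1$), and $a_{t+1}$ corresponds to creating a new part $1$ (a new row, of previous length $0$). Transfers. For $1\le i\le t$, $1\le j\le t+1$, the transfer $\lambda(c_i\to a_j)$ decreases by $1$ the length of the row containing $c_i$, increases by $1$ the length of the row of $a_j$ (if these are the same row, the row length is unchanged), and reorders the row lengths (discarding zeros). The transfer is called admissible if the resulting partition is different from $\lambda$. Partition graph. $G_n$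 is the simple graph whose vertices are the partitions of $n$, with two distinct partitions $\mu,\nu$ adjacent if $\nu$ is obtained from $\mu$ by an admissible transfer. Local admissibility graph. $B(\lambda)$ is the bipartite graph with left vertex set $\{1,\dots,t\}$ and right vertex set (a disjoint copy of) $\{1,\dots,t+1\}$, in which left vertex $i$ and right vertex $j$ are adjacent iff the transfer $\lambda(c_i\to a_j)$ is admissible. Local clique invariants. A clique is a set of pairwise adjacent vertices; $\omega_{\mathrm{loc}}(\lambda):=\max\{|C| : \lambda\in C,\ C\text{ a clique in }G_n\}$ and $\dim_{\mathrm{loc}}(\lambda):=\omega_{\mathrm{loc}}(\lambda)-1$. *)

(* Defs.v *)
From HB Require Import structures.
From mathcomp Require Import all_boot.

Set Implicit Arguments.
Unset Strict Implicit.
Unset Printing Implicit Defensive.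

Definition is_intpart (n : nat) (s : seq nat) : bool :=
  [&& sorted geq s, 0 \notin s & sumn s == n].

Record intpart (n : nat) := IntPart {
  parts :> seq nat;
  partsP : is_intpart n parts
}.

HB.instance Definition _ n := [isSub for @parts n].
HB.instance Definition _ n := [Countable of intpart n by <:].

Lemma leq_sumn_mem (s : seq nat) (x : nat) : x \in s -> x <= sumn s.
Proof.
elim: s => // y s IH; rewrite inE => /orP[/eqP-> | /IH]; first exact: leq_addr.
by move/leq_trans; apply; apply: leq_addl.
Qed.

Lemma leq_size_sumn (s : seq nat) : 0 \notin s -> size s <= sumn s.
Proof.
elim: s => // y s IH; rewrite inE negb_or => /andP[y0 /IH hs] /=.
by rewrite -add1n leq_add // lt0n eq_sym.
Qed.

(* Finiteness: a partition of n is padded with zeros to n rows of length <= n. *)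
Definition intpart_encode n (p : intpart n) : n.-tuple 'I_n.+1 :=
  [tuple inord (nth 0 p i) | i < n].

Definition intpart_decode n (u : n.-tuple 'I_n.+1) : option (intpart n) :=
  insub [seq x <- [seq val i | i <- u] | x != 0].

Lemma intpart_encodeK n : pcancel (@intpart_encode n) (@intpart_decode n).
Proof.
move=> p; rewrite /intpart_decode.
have /and3P[_ p0 /eqP sp] := partsP p.
suff -> : [seq x <- [seq val i | i <- intpart_encode p] | x != 0] = p :> seq nat.
  exact: valK.
rewrite /= -map_comp.
have le_n r : nth 0 p r < n.+1.
  rewrite ltnS; case: (ltnP r (size p)) => hr; last by rewrite nth_default.
  by apply: (leq_trans (leq_sumn_mem (mem_nth 0 hr))); rewrite sp.
rewrite (eq_map (g := fun i : 'I_n => nth 0 p i)); last first.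
  by move=> i /=; rewrite inordK.
rewrite (map_comp (nth 0 p) val) val_enum_ord.
have hs : size p <= n by rewrite -[leqRHS]sp leq_size_sumn.
move: (parts p) p0 hs {le_n sp} => q q0 hs.
rewrite -(subnKC hs) iotaD map_cat filter_cat -/(mkseq _ _) mkseq_nth add0n.
rewrite (eq_in_filter (a2 := predT)) ?filter_predT; last first.
  by move=> x xp; apply: contraNneq q0 => <-.
rewrite (eq_in_filter (a2 := pred0)) ?filter_pred0 ?cats0 // => x.
case/mapP=> r; rewrite mem_iota => /andP[hr _] ->.
by rewrite nth_default.
Qed.

HB.instance Definition _ n :=
  isFinite.Build (intpart n) (pcan_enumP (@intpart_encodeK n)).

(* Since the parts are weakly decreasing, [undup] lists s_1 > ... > s_t. *)
Definition block_sizes n (p : intpart n) : seq nat := undup p.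

Definition nblocks n (p : intpart n) : nat := size (block_sizes p).

(* Indices start at 0; the default value gives s_{t+1} = 0. *)
Definition block_size n (p : intpart n) (k : nat) : nat :=
  nth 0 (block_sizes p) k.

(* The last occurrence of s_i in p. *)
Definition rem_row n (p : intpart n) (i : 'I_(nblocks p)) : nat :=
  size p - (index (block_size p i) (rev p)).+1.

(* For j = t, the size 0 does not occur in p, so [index] is [size p], the index
   of the new row. *)
Definition add_row n (p : intpart n) (j : 'I_(nblocks p).+1) : nat :=
  index (block_size p j) p.

Definition transfer_rows n (p : intpart n) (i : 'I_(nblocks p))
    (j : 'I_(nblocks p).+1) : seq nat :=
  mkseq (fun r => nth 0 p r - (r == rem_row i) + (r == add_row j)) (size p).+1.

Definition transfer_seq n (p : intpart n) (i : 'I_(nblocks p))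
    (j : 'I_(nblocks p).+1) : seq nat :=
  sort geq [seq x <- transfer_rows i j | x != 0].

Lemma block_size_in n (p : intpart n) (i : 'I_(nblocks p)) :
  block_size p i \in parts p.
Proof. by rewrite -mem_undup mem_nth. Qed.

Lemma rem_row_lt n (p : intpart n) (i : 'I_(nblocks p)) : rem_row i < size p.
Proof.
have := block_size_in i; rewrite -mem_rev -index_mem size_rev => h.
by rewrite /rem_row ltn_subrL (leq_ltn_trans _ h).
Qed.

Lemma nth_rem_row n (p : intpart n) (i : 'I_(nblocks p)) :
  nth 0 p (rem_row i) = block_size p i.
Proof.
have h := block_size_in i.
rewrite /rem_row -nth_rev ?nth_index ?mem_rev //.
by rewrite -size_rev index_mem mem_rev.
Qed.

Lemma transfer_seqP n (p : intpart n) (i : 'I_(nblocks p))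
  (j : 'I_(nblocks p).+1) : is_intpart n (transfer_seq i j).
Proof.
have /and3P[_ p0 /eqP sp] := partsP p.
apply/and3P; split.
- by apply: sort_sorted => x y; apply: leq_total.
- by rewrite mem_sort mem_filter.
rewrite /transfer_seq (perm_sumn (permEl (perm_sort _ _))).
have sumn_filter s : sumn [seq x <- s | x != 0] = sumn s.
  by elim: s => //= -[|x] s /= ->.
rewrite sumn_filter sumnE big_map -[iota 0 _]/(index_iota 0 (size p).+1) big_mkord.
rewrite big_split /=.
have one k : k < (size p).+1 -> \sum_(r < (size p).+1) (r == k :> nat) = 1.
  move=> hk; rewrite (bigD1 (Ordinal hk)) //= eqxx big1 // => r.
  by rewrite -val_eqE /= => /negPf->.
have ltr := rem_row_lt i.
have le_nth r : (r == rem_row i) <= nth 0 p r.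
  have [->|//] := eqVneq r; rewrite nth_rem_row lt0n.
  by apply: contraNneq p0 => <-; apply: block_size_in.
rewrite sumnB; last by move=> r _; apply: le_nth.
rewrite !one ?ltnS ?index_size ?(ltnW ltr) // subnK.
  by rewrite big_ord_recr /= nth_default // addn0 -[in X in _ == X]sp
    sumnE (big_nth 0) big_mkord.
rewrite -(one (rem_row i)) ?ltnS ?(ltnW ltr) //.
by apply: leq_sum => r _; apply: le_nth.
Qed.

Definition transfer n (p : intpart n) (i : 'I_(nblocks p))
    (j : 'I_(nblocks p).+1) : intpart n :=
  IntPart (transfer_seqP i j).

Definition admissible n (p : intpart n) (i : 'I_(nblocks p))
    (j : 'I_(nblocks p).+1) : bool :=
  transfer i j != p.

Definition obtained_from n (mu nu : intpart n) : bool :=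
  [exists i : 'I_(nblocks mu), exists j : 'I_(nblocks mu).+1,
     admissible i j && (nu == transfer i j)].

(* G_n is undirected, hence the symmetrization. *)
Definition partition_graph n : rel (intpart n) :=
  fun mu nu => (mu != nu) && (obtained_from mu nu || obtained_from nu mu).

Definition local_graph n (p : intpart n) :
    rel ('I_(nblocks p) + 'I_(nblocks p).+1) :=
  fun x y => match x, y with
  | inl i, inr j | inr j, inl i => admissible i j
  | _, _ => false
  end.

Definition degree (T : finType) (e : rel T) (x : T) : nat := #|[set y | e x y]|.

Definition is_clique (T : finType) (e : rel T) (C : {set T}) : bool :=
  [forall x in C, forall y in C, (x != y) ==> e x y].

Definition omega_loc n (p : intpart n) : nat :=
  \max_(C : {set intpart n} | (p \in C) && is_clique (@partition_graph n) C) #|C|.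

(* [omega_loc p] is positive since [[set p]] is a clique. *)
Definition dim_loc n (p : intpart n) : nat := (omega_loc p).-1.

Definition sigma n (p : intpart n) (i : 'I_(nblocks p)) : nat :=
  degree (@local_graph n p) (inl i).

Definition tau n (p : intpart n) (j : 'I_(nblocks p).+1) : nat :=
  degree (@local_graph n p) (inr j).

(* Main.v *)
Require Import Defs.
From mathcomp Require Import all_boot zify.

(** Pass to the conjugate partition: a partition is determined by its column
    lengths, and decreasing a row of length [a] while increasing another row of
    length [b] moves one cell from column [a - 1] to column [b] (columns being
    numbered from 0) and leaves all the other columns alone.  So an admissible
    transfer adds to the vector of column lengths a difference [e_b - e_c] of
    two distinct unit vectors.  Conversely, whenever the column vectors of two
    partitions differ in this way, the fact that both are weakly decreasing
    forces the cell to leave a removable corner and to arrive at an addable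
    one; hence adjacency in the partition graph is exactly this relation
    between column vectors ([adjacencyP]).

    Let [q] and [q'] be two neighbours of [p], obtained by adding [e_b - e_c]
    and [e_b' - e_c'].  Their difference is again of the form [e_x - e_y] only
    when the two moves have a common source or a common target
    ([cell_move_share]), and it is of this form whenever exactly one of the two
    is common ([cell_move_fan], [cell_move_cofan]).  The neighbours of [p]
    are thus the edges of its local admissibility graph ([transfer_inj]), and a
    clique containing [p] is a set of pairwise incident edges of this graph.  A
    bipartite graph has no triangle, so pairwise incident edges form a star:
    they all contain one left vertex or one right vertex ([clique_star]).
    Conversely every full star is a clique.  The largest clique through [p] is
    [p] together with a star of largest size, that is, of the maximal degree. *)

(** * Columns of a partition and moves of one cell *)

(** Column lengths of the Ferrers diagram, i.e. the parts of the conjugate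
    partition, with columns numbered from 0. *)
Definition column {n} (p : intpart n) (k : nat) : nat := count (ltn k) p.

(** The column vectors satisfy [q = p - e_a + e_b]; the unit vectors are put on
    opposite sides to avoid truncated subtraction. *)
Definition cell_move {n} (p q : intpart n) (a b : nat) : Prop :=
  a != b /\ forall k, column q k + (k == a) = column p k + (k == b).

Lemma columnS {n} (p : intpart n) k :
  column p k = column p k.+1 + count_mem k.+1 p.
Proof.
rewrite /column; elim: (parts p) => //= x s ->.
lia.
Qed.

(** Consecutive columns differ by the multiplicity of a part size, so the columns
    determine all multiplicities, hence the weakly decreasing sequence. *)
Lemma column_inj {n} (p q : intpart n) : column p =1 column q -> p = q.
Proof.
move=> eqc; apply/val_inj => /=.
have /and3P[sp p0 _] := partsP p; have /and3P[sq q0 _] := partsP q.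
apply: (sorted_eq (leT := geq)) => //.
- by move=> x y z xy yz; apply: leq_trans yz xy.
- by move=> x y h; apply/eqP; rewrite eqn_leq andbC.
apply/allP => -[|k] _ /=; first by rewrite !(count_memPn _).
by apply/eqP; have := eqc k; rewrite columnS [column q k]columnS eqc => /addnI.
Qed.

Lemma cell_move_sym {n} {p q : intpart n} {a b} :
  cell_move p q a b -> cell_move q p b a.
Proof. by move=> [ab h]; split=> [|k]; [rewrite eq_sym | rewrite h]. Qed.

Lemma cell_move_neq {n} {p q : intpart n} {a b} : cell_move p q a b -> p != q.
Proof.
case=> ab h; apply/eqP => epq; move: (h a); rewrite epq eqxx (negPf ab); lia.
Qed.

Lemma cell_move_uniq {n} {p q : intpart n} {a b a' b'} :
  cell_move p q a b -> cell_move p q a' b' -> a = a' /\ b = b'.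
Proof.
move=> [ab h] [_ h']; have /negPf ba : b != a by rewrite eq_sym.
split; apply/eqP.
  by move: (h a) (h' a); rewrite eqxx (negPf ab); case: (a == a') => //; lia.
by move: (h b) (h' b); rewrite eqxx ba; case: (b == b') => //; lia.
Qed.

Lemma cell_move_fan {n} {p q q' : intpart n} {a b b'} :
  cell_move p q a b -> cell_move p q' a b' -> b != b' -> cell_move q q' b b'.
Proof.
move=> [_ h] [_ h'] bb'; split=> // k; move: (h k) (h' k); lia.
Qed.

Lemma cell_move_cofan {n} {p q q' : intpart n} {a a' b} :
  cell_move p q a b -> cell_move p q' a' b -> a != a' -> cell_move q q' a' a.
Proof.
move=> [_ h] [_ h'] aa'; split=> [|k]; first by rewrite eq_sym.
move: (h k) (h' k); lia.
Qed.

(** At the coordinates [a] and [b'], the vector [e_b' - e_a' - e_b + e_a] is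
    positive if the sources and the targets both differ; a difference
    [e_d - e_c] is positive only at [d], so [a = d = b'], where the former
    vector is 2. *)
Lemma cell_move_share {n} {p q q' : intpart n} {a b a' b' c d} :
  cell_move p q a b -> cell_move p q' a' b' -> cell_move q q' c d ->
  a = a' \/ b = b'.
Proof.
move=> [ab h] [ab' h'] [cd h2].
have [->|aa'] := eqVneq a a'; first by left.
have [->|bb'] := eqVneq b b'; first by right.
have /negPf ba' : b' != a' by rewrite eq_sym.
have /negPf bb : b' != b by rewrite eq_sym.
have /eqP ad : a == d.
  move: (h a) (h' a) (h2 a); rewrite eqxx (negPf ab) (negPf aa').
  by case: (a == d) => //; lia.
have /eqP bd : b' == d.
  move: (h b') (h' b') (h2 b'); rewrite eqxx ba' bb.
  by case: (b' == d) => //; lia.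
move: (h a) (h' a) (h2 a).
rewrite eqxx (negPf ab) (negPf aa') ad bd eqxx; lia.
Qed.


(** * Removable and addable corners *)

(** The default value 0 at the last index behaves as one more block size, since
    0 is not a part. *)
Lemma block_size_inj {n} (p : intpart n) :
  injective (fun j : 'I_(nblocks p).+1 => block_size p j).
Proof.
have uz : uniq (rcons (undup p) 0).
  by rewrite rcons_uniq undup_uniq mem_undup; have /and3P[_ ->] := partsP p.
have bsE (j : 'I_(nblocks p).+1) : block_size p j = nth 0 (rcons (undup p) 0) j.
  rewrite nth_rcons /block_size /block_sizes; case: ltngtP => // h.
    by rewrite nth_default // ltnW.
  by rewrite nth_default // h.
move=> j j'; rewrite !bsE => /eqP.
by rewrite nth_uniq ?size_rcons // => /eqP /val_inj.
Qed.

Lemma block_sizeP {n} (p : intpart n) x :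
  x \in parts p -> exists i : 'I_(nblocks p), block_size p i = x.
Proof.
rewrite -mem_undup => xp; have lt_x := xp; rewrite -index_mem in lt_x.
by exists (Ordinal lt_x); apply: nth_index.
Qed.

Lemma block_size_gt0 {n} (p : intpart n) (i : 'I_(nblocks p)) :
  0 < block_size p i.
Proof.
have /and3P[_ p0 _] := partsP p.
by rewrite lt0n; apply: contraNneq p0 => <-; apply: block_size_in.
Qed.

Lemma rem_column_inj {n} (p : intpart n) :
  injective (fun i : 'I_(nblocks p) => (block_size p i).-1).
Proof.
move=> i i' eq_a; apply/val_inj.
suff /block_size_inj[] :
  block_size p (widen_ord (leqnSn _) i) = block_size p (widen_ord (leqnSn _) i').
  by [].
by move: eq_a (block_size_gt0 p i) (block_size_gt0 p i') => /=; lia.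
Qed.

Lemma block_size_max {n} (p : intpart n) : block_size p (nblocks p) = 0.
Proof. exact: nth_default. Qed.

Lemma nth_add_row {n} (p : intpart n) (j : 'I_(nblocks p).+1) :
  nth 0 p (add_row j) = block_size p j.
Proof.
rewrite /add_row; have [lt_j|ge_j] := ltnP j (nblocks p).
  exact/nth_index/(block_size_in (Ordinal lt_j)).
rewrite [block_size p j]nth_default //.
have /and3P[_ p0 _] := partsP p.
by rewrite nth_default // leqNgt index_mem.
Qed.

(** The left-hand side of the equation is the position of the last occurrence of
    [b] in [s], the right-hand side that of the first one. *)
Lemma count_first_last (T : eqType) (b : T) (s : seq T) :
  b \in s -> size s - (index b (rev s)).+1 = index b s -> count_mem b s <= 1.
Proof.
elim: s => // x s IH; rewrite inE rev_cons -cats1 index_cat mem_rev /=.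
have [_ _|_ /= b_s] := eqVneq x b.
  case: ifP => [|/negbT/count_memPn->] //.
  by rewrite -mem_rev -index_mem size_rev; lia.
rewrite b_s add0n => rows; apply: IH => //.
have : index b (rev s) < size s by rewrite -size_rev index_mem mem_rev.
lia.
Qed.

(** The removed and the added cell lie in the same row only for a block that
    consists of a single row. *)
Lemma rem_add_row_neq {n} (p : intpart n) (i : 'I_(nblocks p))
    (j : 'I_(nblocks p).+1) :
  (block_size p i = block_size p j -> 1 < count_mem (block_size p i) p) ->
  rem_row i != add_row j.
Proof.
move=> mult; apply/eqP => eq_row.
have eq_b : block_size p i = block_size p j.
  by rewrite -nth_add_row -eq_row nth_rem_row.
move: eq_row (mult eq_b) (block_size_in i); rewrite /rem_row /add_row -eq_b.
by move=> eq_row /[swap] b_p; rewrite ltnNge count_first_last.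
Qed.

(** * Transfers are moves of one cell *)

Lemma column_transfer_rows {n} (p : intpart n) (i : 'I_(nblocks p))
    (j : 'I_(nblocks p).+1) k :
  column (transfer i j) k = count (ltn k) (transfer_rows i j).
Proof.
rewrite /column -[parts (transfer i j)]/(transfer_seq i j) /transfer_seq.
rewrite (permP (permEl (perm_sort _ _))) count_filter.
by apply: eq_count => x /=; lia.
Qed.

(** Shortening a row of length [a] takes its cell in column [a - 1], and
    lengthening a row of length [b] puts a cell in column [b].  The two rows must
    differ, since otherwise the new cell is put in column [a - 1]. *)
Lemma column_transfer {n} (p : intpart n) (i : 'I_(nblocks p))
    (j : 'I_(nblocks p).+1) k :
  rem_row i != add_row j ->
  column (transfer i j) k + (k == (block_size p i).-1)
    = column p k + (k == block_size p j).
Proof.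
move=> neq_row.
have sum_count f m : count (ltn k) (mkseq f m) = \sum_(r < m) (k < f r).
  by rewrite -sumn_count sumnE !big_map -[X in iota 0 X]subn0 big_mkord.
have pE : column p k = \sum_(r < (size p).+1) (k < nth 0 p r).
  rewrite big_ord_recr /= nth_default // addn0.
  by rewrite -sum_count mkseq_nth.
have one x b : x < (size p).+1 -> \sum_(r < (size p).+1) (r == x :> nat) * b = b.
  move=> hx; rewrite (bigD1 (Ordinal hx)) //= eqxx mul1n big1 ?addn0 // => r.
  by rewrite -val_eqE /= => /negPf->.
have lt_rem : rem_row i < (size p).+1 by rewrite ltnW // ltnS rem_row_lt.
have lt_add : add_row j < (size p).+1 by rewrite ltnS index_size.
(* Turn the corrections by one cell into sums over the rows, so that the
   equality can be checked row by row. *)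
rewrite column_transfer_rows sum_count pE -[X in _ + X = _](one _ _ lt_rem).
rewrite -[X in _ = _ + X](one _ _ lt_add) -!big_split /=.
apply: eq_bigr => r _.
have := nth_rem_row i; have := nth_add_row p j; have := block_size_gt0 p i.
have [->|_] := eqVneq (r : nat) (rem_row i).
  by rewrite (negPf neq_row); lia.
by have [->|_] := eqVneq (r : nat) (add_row j); lia.
Qed.

Lemma transfer_same_row {n} (p : intpart n) (i : 'I_(nblocks p))
    (j : 'I_(nblocks p).+1) :
  rem_row i = add_row j -> transfer i j = p.
Proof.
move=> eq_row; apply/column_inj => k.
rewrite column_transfer_rows.
have -> : transfer_rows i j = rcons p 0.
  rewrite /transfer_rows -eq_row -[RHS](mkseq_nth 0) size_rcons.
  apply: eq_mkseq => r; rewrite nth_rcons.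
  have [->|_] := eqVneq r (rem_row i).
    by rewrite rem_row_lt nth_rem_row subnK // block_size_gt0.
  rewrite subn0 addn0; case: (ltnP r (size p)) => // size_le.
  by rewrite if_same nth_default.
by rewrite -cats1 count_cat [count _ [:: 0]]/= !addn0.
Qed.

Lemma admissible_move {n} (p : intpart n) (i : 'I_(nblocks p))
    (j : 'I_(nblocks p).+1) :
  admissible i j ->
  cell_move p (transfer i j) (block_size p i).-1 (block_size p j).
Proof.
move=> adm; have neq_row : rem_row i != add_row j.
  by apply: contraNneq adm => /transfer_same_row->.
have colE k := column_transfer p i j k neq_row.
split=> //; apply: contraNneq adm => eq_b.
by apply/eqP/column_inj => k; have := colE k; rewrite eq_b => /addIn.
Qed.

(** The columns of [q] are weakly decreasing although column [a] has lost a cell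
    and column [b] has gained one: so column [a] of [p] is longer than the next
    one and [a + 1] is a part, and column [b - 1] of [p], if [b > 0], is longer
    than column [b] and [b] is a part.  When [b = a + 1], column [a] must be
    longer by 2, so this part is repeated and the two rows can be chosen
    distinct. *)
Lemma move_admissible {n} {p q : intpart n} {a b} :
  cell_move p q a b ->
  exists (i : 'I_(nblocks p)) (j : 'I_(nblocks p).+1),
    admissible i j /\ q = transfer i j.
Proof.
move=> mv; have [ab colE] := mv.
have part_a : count_mem a.+1 p >= 1 + (a.+1 == b).
  move: (colE a) (colE a.+1) (columnS p a) (columnS q a); lia.
have [i iE] : exists i : 'I_(nblocks p), block_size p i = a.+1.
  by apply/block_sizeP; rewrite -has_pred1 has_count; lia.
have [j jE] : exists j : 'I_(nblocks p).+1, block_size p j = b.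
  case: b ab colE {mv part_a} => [|b] ab colE; first by exists ord_max; apply: block_size_max.
  have [|j jE] := block_sizeP p b.+1; last by exists (widen_ord (leqnSn _) j).
  rewrite -has_pred1 has_count.
  move: (colE b) (colE b.+1) (columnS p b) (columnS q b); lia.
have neq_row : rem_row i != add_row j.
  by apply: rem_add_row_neq; rewrite iE jE; lia.
have qE : q = transfer i j.
  apply/column_inj => k; apply/(@addIn (k == a)); rewrite colE.
  by have := column_transfer p i j k neq_row; rewrite iE jE.
by exists i, j; rewrite /admissible -qE eq_sym (cell_move_neq mv).
Qed.

(** The set of cell moves is closed under reversal, so the symmetrization in
    the partition graph adds no new neighbour. *)
Lemma adjacencyP {n} (p q : intpart n) :
  reflect (exists a b, cell_move p q a b) (partition_graph p q).
Proof.
have obtained_move (x y : intpart n) : obtained_from x y ->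
    exists a b, cell_move x y a b.
  case/existsP=> i /existsP[j /andP[adm /eqP->]].
  by do 2!eexists; apply: admissible_move adm.
apply: (iffP idP) => [/andP[_ /orP[|]] /obtained_move // [a [b mv]]|[a [b mv]]].
  by exists b, a; apply: cell_move_sym.
rewrite /partition_graph (cell_move_neq mv) /=; apply/orP; left.
have [i [j [adm ->]]] := move_admissible mv.
by apply/existsP; exists i; apply/existsP; exists j; rewrite adm eqxx.
Qed.

Lemma transfer_inj {n} {p : intpart n} {i i' : 'I_(nblocks p)}
    {j j' : 'I_(nblocks p).+1} :
  admissible i j -> admissible i' j' -> transfer i j = transfer i' j' ->
  i = i' /\ j = j'.
Proof.
move=> /admissible_move mv /admissible_move + eq_t; rewrite -eq_t => mv'.
have [eq_a eq_b] := cell_move_uniq mv mv'; split; first exact: rem_column_inj eq_a.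
exact: block_size_inj eq_b.
Qed.

Lemma adjacent_share {n} {p : intpart n} {i i' : 'I_(nblocks p)}
    {j j' : 'I_(nblocks p).+1} :
  admissible i j -> admissible i' j' ->
  partition_graph (transfer i j) (transfer i' j') -> i = i' \/ j = j'.
Proof.
move=> /admissible_move mv /admissible_move mv' /adjacencyP[c [d mv2]].
by case: (cell_move_share mv mv' mv2) => [/rem_column_inj|/block_size_inj];
  [left | right].
Qed.

(** * Stars of the local admissibility graph and cliques *)

Lemma sigmaE {n} (p : intpart n) (i : 'I_(nblocks p)) :
  sigma i = #|[set j | admissible i j]|.
Proof.
rewrite /sigma /degree -[RHS](card_imset _ (@inr_inj 'I_(nblocks p) _)).
apply: eq_card => -[i'|j]; rewrite !inE /=.
  by apply/esym/negP => /imsetP[].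
by rewrite mem_imset ?inE //; apply: inr_inj.
Qed.

Lemma tauE {n} (p : intpart n) (j : 'I_(nblocks p).+1) :
  tau j = #|[set i | admissible i j]|.
Proof.
rewrite /tau /degree -[RHS](card_imset _ (@inl_inj _ 'I_(nblocks p).+1)).
apply: eq_card => -[i|j']; rewrite !inE /=; last first.
  by apply/esym/negP => /imsetP[].
by rewrite mem_imset ?inE //; apply: inl_inj.
Qed.

Lemma partition_graph_sym {n} : symmetric (@partition_graph n).
Proof. by move=> p q; rewrite /partition_graph eq_sym orbC. Qed.

Lemma star_omega_loc {n} (p : intpart n) (T : finType) (A : {set T})
    (f : T -> intpart n) :
  (forall x, x \in A -> partition_graph p (f x)) ->
  {in A &, forall x y, x != y -> partition_graph (f x) (f y)} ->
  #|A| < omega_loc p.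
Proof.
move=> adj_p adj_f.
have pf : p \notin f @: A.
  by apply/imsetP => -[x /adj_p + eq_p]; rewrite -eq_p /partition_graph eqxx.
have f_inj : {in A &, injective f}.
  move=> x y xA yA eq_f; apply/eqP; apply: contraT => /(adj_f x y xA yA).
  by rewrite eq_f /partition_graph eqxx.
rewrite -(card_in_imset f_inj) -add1n; move: (cardsU1 p (f @: A)).
rewrite pf => <-; apply: leq_bigmax_cond; rewrite setU11 /=.
apply/forall_inP => q /setU1P[->|/imsetP[x xA ->]];
  apply/forall_inP => q' /setU1P[->|/imsetP[y yA ->]]; apply/implyP.
- by rewrite eqxx.
- by move=> _; apply: adj_p.
- by move=> _; rewrite partition_graph_sym; apply: adj_p.
- by move=> neq; apply: adj_f => //; apply: contraNneq neq => ->.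
Qed.

Lemma admissible_adj {n} (p : intpart n) (i : 'I_(nblocks p))
    (j : 'I_(nblocks p).+1) :
  admissible i j -> partition_graph p (transfer i j).
Proof.
by move=> /admissible_move mv; apply/adjacencyP; do 2!eexists; exact: mv.
Qed.

Lemma sigma_lt_omega_loc {n} (p : intpart n) (i : 'I_(nblocks p)) :
  sigma i < omega_loc p.
Proof.
rewrite sigmaE; apply: (star_omega_loc p _ _ (transfer i)) => [j|j j'].
  by rewrite inE; apply: admissible_adj.
rewrite !inE => /admissible_move mv /admissible_move mv' neq_j.
apply/adjacencyP; do 2!eexists; apply: cell_move_fan mv mv' _.
by apply: contraNneq neq_j => /block_size_inj->.
Qed.

Lemma tau_lt_omega_loc {n} (p : intpart n) (j : 'I_(nblocks p).+1) :
  tau j < omega_loc p.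
Proof.
rewrite tauE; apply: (star_omega_loc p _ _ (fun i => transfer i j)) => [i|i i'].
  by rewrite inE; apply: admissible_adj.
rewrite !inE => /admissible_move mv /admissible_move mv' neq_i.
apply/adjacencyP; do 2!eexists; apply: cell_move_cofan mv mv' _.
by apply: contraNneq neq_i => /rem_column_inj->.
Qed.

(** Pairwise incident edges of a bipartite graph form a star: if two of the edges,
    with ends [i0, j0] and [i1, j0], differ on the left, then an edge that meets
    both without containing [j0] would contain both [i0] and [i1]. *)
Lemma clique_star {n} (p : intpart n) (C : {set intpart n}) :
  p \in C -> is_clique (@partition_graph n) C -> C != [set p] ->
  (exists i : 'I_(nblocks p), C \subset p |: transfer i @: [set j | admissible i j])
  \/ (exists j : 'I_(nblocks p).+1,
        C \subset p |: (fun i => transfer i j) @: [set i | admissible i j]).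
Proof.
move=> pC /forall_inP clqC neqC.
have adjC q q' : q \in C -> q' \in C -> q != q' -> partition_graph q q'.
  by move=> qC q'C neq; have /forall_inP/(_ q' q'C)/implyP/(_ neq) := clqC q qC.
have trC q : q \in C -> q != p -> exists (i : 'I_(nblocks p))
    (j : 'I_(nblocks p).+1), admissible i j /\ q = transfer i j.
  move=> qC; rewrite eq_sym => /(adjC _ _ pC qC)/adjacencyP[a [b mv]].
  exact: move_admissible mv.
have shareC (i : 'I_(nblocks p)) j (i' : 'I_(nblocks p)) j' : admissible i j -> admissible i' j' ->
    transfer i j \in C -> transfer i' j' \in C -> i = i' \/ j = j'.
  move=> adm adm' tC t'C; have [eq_t|neq_t] := eqVneq (transfer i j) (transfer i' j').
    by left; have [] := transfer_inj adm adm' eq_t.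
  exact: adjacent_share adm adm' (adjC _ _ tC t'C neq_t).
have [q0 q0C q0p] : exists2 q, q \in C & q != p.
  apply/exists_inP; apply: contraNT neqC => /exists_inPn all_p.
  apply/eqP/setP => q; rewrite inE; apply/idP/eqP => [/all_p/negPn/eqP//|->//].
(* Some edge [i0, j0] is fixed; unless all edges contain [i0], some other edge
   avoids [i0] and so shares [j0] with the first. *)
have [i0 [j0 [adm0 q0E]]] := trC q0 q0C q0p; rewrite {}q0E {q0p} in q0C.
have [allI|/subsetPn[q1 q1C]] :=
  boolP (C \subset p |: transfer i0 @: [set j | admissible i0 j]).
  by left; exists i0.
rewrite in_setU1 negb_or => /andP[q1p q1i0].
have [i1 [j1 [adm1 q1E]]] := trC q1 q1C q1p; rewrite {}q1E {q1p} in q1C q1i0.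
have neq_i : i0 <> i1.
  by move=> eq_i; case/imsetP: q1i0; subst i1; exists j1; rewrite ?inE.
have eq_j : j0 = j1 by case: (shareC _ _ _ _ adm0 adm1 q0C q1C).
subst j1; right; exists j0; apply/subsetP => q qC; rewrite in_setU1.
have [//|qp] := eqVneq q p; have [i [j [adm qE]]] := trC q qC qp.
have eq_j : j = j0.
  rewrite qE in qC; have [ei|//] := shareC _ _ _ _ adm adm0 qC q0C.
  by have [ei1|//] := shareC _ _ _ _ adm adm1 qC q1C; case: neq_i; rewrite -ei.
by apply/imsetP; exists i; rewrite ?inE -?eq_j.
Qed.

Theorem proposition5p4 (n : nat) (lam : intpart n)
    (hn : 1 <= n) :
  omega_loc lam =
    1 + maxn (\max_(i < nblocks lam) sigma i) (\max_(j < (nblocks lam).+1) tau j)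
  /\
  dim_loc lam =
    maxn (\max_(i < nblocks lam) sigma i) (\max_(j < (nblocks lam).+1) tau j).
Proof.
set m := maxn _ _.
suff omegaE : omega_loc lam = 1 + m by rewrite /dim_loc omegaE.
apply/eqP; rewrite eqn_leq; apply/andP; split.
  apply/bigmax_leqP => C /andP[lamC clqC].
  have [->|neqC] := eqVneq C [set lam]; first by rewrite cards1.
  have cardU A : C \subset lam |: A -> #|C| <= 1 + #|A|.
    by move/subset_leq_card/leq_trans; apply; rewrite cardsU1 leq_add2r leq_b1.
  have [[i /cardU]|[j /cardU]] := clique_star lam C lamC clqC neqC;
    move/leq_trans; apply; rewrite leq_add2l;
    apply: leq_trans (leq_imset_card _ _) _.
    by rewrite -sigmaE leq_max leq_bigmax.
  by rewrite -tauE leq_max leq_bigmax // orbT.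
have omega_gt0 : 0 < omega_loc lam by apply: leq_ltn_trans (tau_lt_omega_loc lam ord0).
rewrite add1n -(prednK omega_gt0) ltnS geq_max.
by apply/andP; split; apply/bigmax_leqP => k _; rewrite -ltnS prednK //;
  [apply: sigma_lt_omega_loc | apply: tau_lt_omega_loc].
Qed.
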